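(* Let $P$ and $R$ be the $N(M+1)\times N(M+1)$ matrices defined in the context. If the temporal steps $\tau_k>0$ satisfy $$\tau_k<\min_{i,j}\left\{\min\left(\Delta\mu_i\Delta\mu_{i-1},\ \Delta\theta_j\Delta\theta_{j-1}\right)\psi_{i,j}^{-1}\right\},$$ where the minimum is over $i=1,\dots,N$, $j=0,\dots,M$, then the adaptive splitting scheme $$v_{k+1}=S(\tau_k)v_k+\tfrac{\tau_k}{2}\left(g(w_{k+1})+S(\tau_k)g(v_k)\right)$$ with fixed nonuniform grids and the nonlinear term frozen is weakly stable in the von Neumann sense under the $\ell_\infty$-norm. That is, $$\|z_{k+1}\|_\infty\le\|z_m\|_\infty,$$ where $z_m=v_m-\tilde v_m$ is a perturbation or error at time step $m$ and $z_{k+1}=v_{k+1}-\tilde v_{k+1}$ is the perturbation or error arising after taking $k+1-m$ steps.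
   Context: The time-step condition is imposed at every step taken. In the scheme, $g$ is the discretized reaction term, $w_{k+1}$ is a suitable approximation of $v_{k+1}$, and $$S(\tau)=\left(I-\tfrac{\tau}{2}R\right)^{-1}\left(I-\tfrac{\tau}{2}P\right)^{-1}\left(I+\tfrac{\tau}{2}P\right)\left(I+\tfrac{\tau}{2}R\right).$$ ''Nonlinear term frozen'' means that the nonlinear contributions are treated as fixed (unaffected by the perturbation), so that only the amplification matrix acts on the perturbation: $z_{k+1}=S(\tau_k)z_k$. For a vector, $\|v\|_\infty=\max_i|v_i|$. Grid and coefficients. The elliptical domain is described by coordinates $x=a\cosh\mu\cos\theta$, $y=a\sinh\mu\sin\theta$ with $a>0$, $\mu\in[0,\zeta]$, $\theta\in[0,2\pi)$. Let $N,M$ be positive integers. The grid is $\theta_0=0$, $\theta_j=\theta_{j-1}+\Delta\theta_{j-1}$ for $j=1,\dots,M+1$, $\theta_{M+1}=2\pi$; and $\mu_0=-\Delta\mu_0/2$, $\mu_i=\mu_{i-1}+\Delta\mu_{i-1}$ for $i=1,\dots,N+1$, $\mu_{N+1}=\zeta$; all (nonuniform) steps $\Delta\mu_i,\Delta\theta_j$ are positive. By periodicity in $\theta$, $\Delta\theta_{-1}=\Delta\theta_M$. Let $\psi_{i,j}=\phi_{i,j}/s_{i,j}$ for $i=1,\dots,N$, $j=0,\dots,M$, where $\phi_{i,j}=\phi(\mu_i,\theta_j)$, $\phi(\mu,\theta)=\dfrac{1}{a^2(\sinh^2\mu+\sin^2\theta)}$, and $s_{i,j}=s(\mu_i,\theta_j)>0$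 are the values of the degeneracy function $s$, which is positive inside the domain. Matrices. $T_\mu$ is the $N\times N$ tridiagonal matrix whose row $i$ ($i=1,\dots,N$) has diagonal entry $-\frac{2}{\Delta\mu_i\Delta\mu_{i-1}}$, subdiagonal entry $\frac{2}{\Delta\mu_{i-1}(\Delta\mu_i+\Delta\mu_{i-1})}$ and superdiagonal entry $\frac{2}{\Delta\mu_i(\Delta\mu_i+\Delta\mu_{i-1})}$ (where these positions exist). $T_\theta$ is the $(M+1)\times(M+1)$ tridiagonal matrix, with rows indexed by $j=0,\dots,M$, defined in the same way with $\Delta\theta_j,\Delta\theta_{j-1}$ in place of $\Delta\mu_i,\Delta\mu_{i-1}$. $C_\mu\in\mathbb{R}^{(M+1)\times(M+1)}$ is the permutation matrix (indices $0,\dots,M$) with a 1 in position $(0,0)$ and in positions $(j,M+1-j)$, $j=1,\dots,M$, and zeros elsewhere. $C_\theta\in\mathbb{R}^{(M+1)\times(M+1)}$ has only two nonzero entries: $\kappa_1=\frac{2}{\Delta\theta_M(\Delta\theta_0+\Delta\theta_M)}$ in the top right corner and $\kappa_2=\frac{2}{\Delta\theta_M(\Delta\theta_{M-1}+\Delta\theta_M)}$ in the bottom left corner. $\hat I_N\in\mathbb{R}^{N\times N}$ has the single nonzero entry $\kappa_3=\frac{2}{\Delta\mu_0(\Delta\mu_1+\Delta\mu_0)}$ in its top left corner. $I_N$, $I_{M+1}$, $I$ are identity matrices. Unknowns are ordered as $(u_{1,0},\dots,u_{N,0},u_{1,1},\dots,u_{N,M})$, and $B$ is the diagonal matrix with entries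 $\psi_{i,j}$ in this order. Then $$P=B\left(I_{M+1}\otimes T_\mu+C_\mu\otimes\hat I_N\right),\qquad R=B\left(T_\theta\otimes I_N+C_\theta\otimes I_N\right).$$ *)

(* Defs.v *)
From HB Require Import structures.
From mathcomp Require Export all_boot all_order all_algebra.
From mathcomp Require Export all_classical all_reals all_analysis.
From mathcomp Require Export mxtens.

Set Implicit Arguments.
Unset Strict Implicit.
Unset Printing Implicit Defensive.

Import Order.TTheory GRing.Theory Num.Theory.

Local Open Scope ring_scope.

Section EllipticGrid.
Variable R : realType.

Definition sinh (x : R) : R := (expR x - expR (- x)) / 2.

Definition phi (a mu theta : R) : R :=
  1 / (a ^+ 2 * (sinh mu ^+ 2 + sin theta ^+ 2)).

(* The point of elliptic coordinates (mu, theta) lies inside the ellipse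
   mu = zeta; the segment mu = 0 joining the foci is interior. *)
Definition inside_ellipse (zeta mu theta : R) : Prop :=
  0 <= mu < zeta /\ 0 <= theta < 2 * pi.

Definition theta_grid (M : nat) (theta dtheta : nat -> R) : Prop :=
  [/\ forall j, (j <= M)%N -> 0 < dtheta j,
      theta 0%N = 0,
      forall j, (1 <= j <= M.+1)%N -> theta j = theta j.-1 + dtheta j.-1
    & theta M.+1 = 2 * pi].

Definition mu_grid (N : nat) (zeta : R) (mu dmu : nat -> R) : Prop :=
  [/\ forall i, (i <= N)%N -> 0 < dmu i,
      mu 0%N = - (dmu 0%N / 2),
      forall i, (1 <= i <= N.+1)%N -> mu i = mu i.-1 + dmu i.-1
    & mu N.+1 = zeta].

(* [dtheta_prev M dtheta j] is the step of index j - 1, where by periodicity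
   the step of index -1 is the one of index M. *)
Definition dtheta_prev (M : nat) (dtheta : nat -> R) (j : nat) : R :=
  if j is j'.+1 then dtheta j' else dtheta M.

Definition psi (a : R) (s : R -> R -> R) (mu theta : nat -> R) (i j : nat) : R :=
  phi a (mu i) (theta j) / s (mu i) (theta j).

(* Second difference matrix on a nonuniform grid; [next r] and [prev r] are
   the steps on either side of the node of row r. *)
Definition second_diff (n : nat) (next prev : nat -> R) : 'M[R]_n :=
  \matrix_(r < n, c < n)
    if c == r :> nat then - (2 / (next r * prev r))
    else if c.+1 == r :> nat then 2 / (prev r * (next r + prev r))
    else if c == r.+1 :> nat then 2 / (next r * (next r + prev r))
    else 0.

(* Row r carries the index i = r + 1, for i = 1, ..., N. *)
Definition T_mu (N : nat) (dmu : nat -> R) : 'M[R]_N :=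
  second_diff N (fun r => dmu r.+1) dmu.

Definition T_theta (M : nat) (dtheta : nat -> R) : 'M[R]_M.+1 :=
  second_diff M.+1 dtheta (dtheta_prev M dtheta).

Definition C_mu (M : nat) : 'M[R]_M.+1 :=
  \matrix_(r < M.+1, c < M.+1)
    if [|| (r == 0 :> nat) && (c == 0 :> nat)
         | (1 <= r)%N && (c == (M.+1 - r)%N :> nat)] then 1 else 0.

Definition C_theta (M : nat) (dtheta : nat -> R) : 'M[R]_M.+1 :=
  let kappa1 := 2 / (dtheta M * (dtheta 0%N + dtheta M)) in
  let kappa2 := 2 / (dtheta M * (dtheta M.-1 + dtheta M)) in
  \matrix_(r < M.+1, c < M.+1)
    if (r == 0 :> nat) && (c == M :> nat) then kappa1
    else if (r == M :> nat) && (c == 0 :> nat) then kappa2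
    else 0.

Definition I_hat (N : nat) (dmu : nat -> R) : 'M[R]_N :=
  let kappa3 := 2 / (dmu 0%N * (dmu 1%N + dmu 0%N)) in
  \matrix_(r < N, c < N)
    if (r == 0 :> nat) && (c == 0 :> nat) then kappa3 else 0.

(* The unknown u_{i,j} has position j * N + (i - 1), which is
   [mxtens_index (j, i - 1)], so that [*t] is the Kronecker product for this
   ordering. *)
Definition B_mx (N M : nat) (ps : nat -> nat -> R) : 'M[R]_(M.+1 * N) :=
  diag_mx (\row_(k < M.+1 * N)
    let: (j, r) := mxtens_unindex k in ps r.+1 j).

Definition P_mx (N M : nat) (ps : nat -> nat -> R) (dmu : nat -> R) :
    'M[R]_(M.+1 * N) :=
  B_mx N M ps *m ((1%:M : 'M[R]_M.+1) *t T_mu N dmu + C_mu M *t I_hat N dmu).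

Definition R_mx (N M : nat) (ps : nat -> nat -> R) (dtheta : nat -> R) :
    'M[R]_(M.+1 * N) :=
  B_mx N M ps *m (T_theta M dtheta *t (1%:M : 'M[R]_N)
                  + C_theta M dtheta *t (1%:M : 'M[R]_N)).

Definition S_mx (n : nat) (P Q : 'M[R]_n) (tau : R) : 'M[R]_n :=
  invmx (1%:M - (tau / 2) *: Q) *m invmx (1%:M - (tau / 2) *: P)
    *m (1%:M + (tau / 2) *: P) *m (1%:M + (tau / 2) *: Q).

(* One step from v, where gw and gv are the values taken by the reaction
   terms g(w_{k+1}) and g(v_k). *)
Definition splitting_step (n : nat) (P Q : 'M[R]_n) (tau : R)
    (gw gv v : 'cV[R]_n) : 'cV[R]_n :=
  S_mx P Q tau *m v + (tau / 2) *: (gw + S_mx P Q tau *m gv).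

(* The neutral element +oo makes this the minimum over the nonempty index set
   i = 1, ..., N, j = 0, ..., M. *)
Definition step_bound (N M : nat) (ps : nat -> nat -> R)
    (dmu dtheta : nat -> R) : \bar R :=
  \big[Order.min/+oo%E]_(r < N) \big[Order.min/+oo%E]_(j < M.+1)
    (Num.min (dmu r.+1 * dmu r) (dtheta j * dtheta_prev M dtheta j)
       * (ps r.+1 j)^-1)%:E.

End EllipticGrid.

(* Main.v *)
(* A matrix A with nonnegative off-diagonal entries and nonpositive row sums
   makes (I - cA)^-1 an l_oo contraction for every c >= 0, by the discrete
   maximum principle, and also I + cA as long as 1 + c A_ii >= 0. Both P and R
   have this form: the second-difference weights of a row cancel its diagonal
   entry, and the extra entries of C_mu (x) I_hat and C_theta only put back
   weights that were cut off at the boundary. The step restriction is the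
   diagonal condition for c = tau / 2, so all four factors of S(tau) are
   contractions, and so is every step of the perturbation. *)
Require Import Defs.
From mathcomp Require Import zify ring lra.

Import Order.TTheory GRing.Theory Num.Theory.

Local Open Scope ring_scope.

(** * Maximum norm, dissipative matrices and contractions *)

Lemma mx_norm_le (K : realDomainType) (m n : nat) (x : 'M[K]_(m, n)) (b : K) :
  0 <= b -> (forall i j, `|x i j| <= b) -> mx_norm x <= b.
Proof.
by move=> b0 le_xb; rewrite mx_normrE; apply: bigmax_le => // -[i j] _.
Qed.

Lemma normr_le_mx_norm (K : realDomainType) (m n : nat) (x : 'M[K]_(m, n)) i j :
  `|x i j| <= mx_norm x.
Proof. by rewrite mx_normrE; exact: (le_bigmax _ _ (i, j)). Qed.

Lemma mx_norm_ge0 (K : realDomainType) (m n : nat) (x : 'M[K]_(m, n)) :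
  0 <= mx_norm x.
Proof. by rewrite mx_normrE; exact: bigmax_ge_id. Qed.

Definition dissipative {K : realFieldType} {n : nat} (A : 'M[K]_n) : Prop :=
  (forall i j, i != j -> 0 <= A i j) /\ (forall i, \sum_j A i j <= 0).

(** Stated on columns, where [mx_norm] is the $\ell_\infty$ norm; [mx_norm A] itself would only be
    the largest entry, not the induced operator norm. *)
Definition contraction {K : realFieldType} {n : nat} (A : 'M[K]_n) : Prop :=
  forall x : 'cV[K]_n, mx_norm (A *m x) <= mx_norm x.

Section Contractions.
Context (K : realFieldType) (n : nat).
Implicit Types (A B : 'M[K]_n) (c : K).

Lemma contractionM A B :
  contraction A -> contraction B -> contraction (A *m B).
Proof.
by move=> hA hB x; rewrite -mulmxA; apply: le_trans (hA _) (hB _).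
Qed.

Lemma dissipative_diag_mul (d : 'rV[K]_n) A :
  (forall i, 0 <= d 0 i) -> dissipative A -> dissipative (diag_mx d *m A).
Proof.
move=> d0 [off rows]; rewrite mul_diag_mx; split=> [i j ij|i].
  by rewrite mxE mulr_ge0 // off.
under eq_bigr do rewrite mxE.
by rewrite -mulr_sumr mulr_ge0_le0.
Qed.

(* I + cA is then a nonnegative matrix whose row sums are at most 1. *)
Lemma contraction_forward A c :
  dissipative A -> 0 <= c -> (forall i, 0 <= 1 + c * A i i) ->
  contraction (1%:M + c *: A).
Proof.
move=> [off rows] c0 diag x.
have ge0 i j : 0 <= (1%:M + c *: A) i j.
  rewrite !mxE; have [->|ij] := eqVneq i j; first exact: diag.
  by rewrite add0r mulr_ge0 ?off.
apply: mx_norm_le => [|i j]; first exact: mx_norm_ge0.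
rewrite [X in `|X|]mxE; apply: le_trans (ler_norm_sum _ _ _) _.
apply: (@le_trans _ _ (\sum_k (1%:M + c *: A) i k * mx_norm x)).
  by apply: ler_sum => k _; rewrite normrM ger0_norm ?ler_wpM2l ?normr_le_mx_norm.
rewrite -mulr_suml ler_piMl ?mx_norm_ge0 //.
under eq_bigr do rewrite !mxE.
rewrite big_split /= -mulr_sumr (bigD1 i) //= eqxx big1 => [|k ki]; last first.
  by rewrite eq_sym (negbTE ki).
by rewrite addr0 gerDl mulr_ge0_le0.
Qed.

(* Compare both sides at an entry where |x| is largest. *)
Lemma mx_norm_backward A c (x : 'cV[K]_n) :
  dissipative A -> 0 <= c -> mx_norm x <= mx_norm ((1%:M - c *: A) *m x).
Proof.
move=> [off rows] c0; have [->|x0] := eqVneq (mx_norm x) 0.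
  exact: mx_norm_ge0.
have [[i j] /= xE] := mx_norm_neq0 x0.
set y := _ *m x.
have yE : y i j = x i j - c * (A i i * x i j)
                  - c * \sum_(k | k != i) A i k * x k j.
  rewrite /y mulmxBl mul1mx -scalemxAl !mxE (bigD1 i) //=.
  by rewrite mulrDr opprD addrA.
have sumA : \sum_(k | k != i) A i k <= - A i i.
  by have := rows i; rewrite (bigD1 i) //= -lerBrDl sub0r.
have A0 : A i i <= 0.
  rewrite -oppr_ge0; apply: le_trans sumA.
  by apply: sumr_ge0 => k ki; apply: off; rewrite eq_sym.
have hS : `|\sum_(k | k != i) A i k * x k j| <= - A i i * `|x i j|.
  apply: le_trans (ler_norm_sum _ _ _) _.
  apply: (@le_trans _ _ (\sum_(k | k != i) A i k * `|x i j|)).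
    apply: ler_sum => k ki; have Aik : 0 <= A i k by apply: off; rewrite eq_sym.
    by rewrite normrM ger0_norm ?ler_wpM2l // -xE normr_le_mx_norm.
  by rewrite -mulr_suml ler_wpM2r.
rewrite xE; apply: le_trans (normr_le_mx_norm _ _ _ y i j).
have -> : y i j = (1 - c * A i i) * x i j
                  - c * \sum_(k | k != i) A i k * x k j by rewrite yE; ring.
(* The surplus [- c * A i i] in the first factor pays exactly for the off-diagonal sum bounded in
   [hS], which leaves [|x i j|]. *)
apply: le_trans (lerB_dist _ _).
have cA : c * A i i <= 0 by rewrite mulr_ge0_le0.
rewrite !normrM (@ger0_norm _ (1 - _)) ?(ger0_norm c0); last by lra.
have := ler_wpM2l c0 hS; lra.
Qed.

(** By [mx_norm_backward] the kernel is trivial. [det0P] speaks of row vectors, hence the passage to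
    the transpose. *)
Lemma unitmx_backward A c :
  dissipative A -> 0 <= c -> 1%:M - c *: A \in unitmx.
Proof.
move=> hA c0; rewrite -unitmx_tr unitmxE unitfE.
apply/det0P => -[u u0 uA]; move: u0.
rewrite -[u]trmxK; have -> : u^T = 0; last by rewrite trmx0 eqxx.
apply/mx_norm_eq0/le_anti; rewrite mx_norm_ge0 andbT.
apply: le_trans (mx_norm_backward A c _ hA c0) _.
by rewrite -[_ *m _]trmxK trmx_mul trmxK uA trmx0 mx_norm0.
Qed.

(** This is [mx_norm_backward] at the image vector. Invertibility matters because [invmx] returns a
    singular matrix unchanged. *)
Lemma contraction_backward A c :
  dissipative A -> 0 <= c -> contraction (invmx (1%:M - c *: A)).
Proof.
move=> hA c0 x; apply: le_trans (mx_norm_backward A c _ hA c0) _.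
by rewrite mulKVmx // unitmx_backward.
Qed.

End Contractions.

Lemma contraction_S_mx (R : realType) (n : nat) (P Q : 'M[R]_n) (tau : R) :
  0 <= tau -> dissipative P -> dissipative Q ->
  (forall i, 0 <= 1 + tau / 2 * P i i) ->
  (forall i, 0 <= 1 + tau / 2 * Q i i) -> contraction (S_mx P Q tau).
Proof.
move=> tau0 hP hQ dP dQ; have c0 : 0 <= tau / 2 by rewrite divr_ge0.
rewrite /S_mx; do !apply: contractionM.
- exact: contraction_backward.
- exact: contraction_backward.
- exact: contraction_forward.
- exact: contraction_forward.
Qed.

(** * Row sums of banded and Kronecker matrices *)

Lemma sum_if_eq_ord (V : nmodType) (n k : nat) (x : V) :
  \sum_(c < n) (if c == k :> nat then x else 0) = if (k < n)%N then x else 0.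
Proof.
have [kn|nk] := ltnP k n.
  by rewrite -big_mkcond (big_pred1 (Ordinal kn)).
by rewrite big1 // => c _; case: eqP nk => // <-; rewrite leqNgt ltn_ord.
Qed.

(** Reduces the row sums of [P_mx] and [R_mx] to those of their one-dimensional factors. *)
Lemma sum_tensmx_row (K : pzRingType) (m n p q : nat) (A : 'M[K]_(m, n))
    (B : 'M[K]_(p, q)) i j :
  \sum_k (A *t B) (mxtens_index (i, j)) k
  = (\sum_k A i k) * (\sum_k B j k).
Proof. by rewrite mulr_sum; apply: eq_bigr => k _; rewrite mxE mxtens_indexK. Qed.

(** Since 1/p + 1/q = (q + p)/(qp); hence the second difference kills constants at interior
    nodes. *)
Lemma second_diff_weights (K : fieldType) (p q : K) :
  p != 0 -> q != 0 -> q + p != 0 ->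
  2 / (p * (q + p)) + 2 / (q * (q + p)) = 2 / (q * p).
Proof. by move=> p0 q0 pq0; field; rewrite p0 q0 pq0. Qed.

(** * Second differences on a nonuniform grid *)

Section SecondDifferences.
Context (R : realType) (n : nat) (next prev : nat -> R).
Hypothesis next0 : forall r, (r < n)%N -> 0 < next r.
Hypothesis prev0 : forall r, (r < n)%N -> 0 < prev r.

Lemma second_diff_offdiag (r c : 'I_n) :
  r != c -> 0 <= second_diff n next prev r c.
Proof.
move=> rc; rewrite mxE val_eqE eq_sym (negbTE rc).
have := next0 r (ltn_ord r); have := prev0 r (ltn_ord r) => q0 p0.
by do 2?case: ifP => // _; rewrite divr_ge0 // mulr_ge0 ?addr_ge0 ?ltW.
Qed.

Lemma second_diff_diag (r : 'I_n) :
  second_diff n next prev r r = - (2 / (next r * prev r)).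
Proof. by rewrite mxE eqxx. Qed.

(** Only the weights of neighbours cut off at the two ends survive; the corner matrices are later
    compared with them. *)
Lemma sum_second_diff_row (r : 'I_n) :
  \sum_c second_diff n next prev r c
  = - (if r == 0 :> nat then 2 / (prev r * (next r + prev r)) else 0)
    - (if r.+1 == n then 2 / (next r * (next r + prev r)) else 0).
Proof.
set d := 2 / (next r * prev r).
set lo := 2 / (prev r * _); set hi := 2 / (next r * (_ + _)).
have dE : lo + hi = d.
  have := next0 r (ltn_ord r); have := prev0 r (ltn_ord r) => q0 p0.
  by rewrite second_diff_weights // gt_eqF // addr_gt0.
(* The three positions are disjoint, so the nested conditional is a sum of three indicators. *)
transitivity (\sum_(c < n) ((if c == r :> nat then - d else 0)
   + (if c.+1 == r :> nat then lo else 0)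
   + (if c == r.+1 :> nat then hi else 0))).
  apply: eq_bigr => c _; rewrite mxE -/d -/lo -/hi.
  case: (ltngtP c r) => [cr|rc|->].
  - by rewrite (ltn_eqF (leqW cr)) add0r addr0.
  - by rewrite (gtn_eqF (leqW rc)) !add0r.
  - by rewrite (gtn_eqF (ltnSn r)) (ltn_eqF (ltnSn r)) !addr0.
rewrite !big_split /= !sum_if_eq_ord ltn_ord.
(* Row 0 has no left neighbour; in any other row the index [r - 1] is in range. *)
have -> : \sum_(c < n) (if c.+1 == r :> nat then lo else 0)
          = if r == 0 :> nat then 0 else lo.
  case: r @d @lo @hi dE => [[|r] rn] d lo hi dE /=; first by rewrite big1.
  by under eq_bigr do rewrite eqSS; rewrite sum_if_eq_ord (ltnW rn).
have -> : (r.+1 < n)%N = (r.+1 != n) by rewrite ltn_neqAle ltn_ord andbT.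
by rewrite -dE; case: (r == 0 :> nat); case: (r.+1 == n) => /=; ring.
Qed.

End SecondDifferences.

(** * The matrices [P] and [R] under the step restriction *)

Section Splitting.
Context (R : realType) (N M : nat) (ps : nat -> nat -> R) (dmu dtheta : nat -> R).
Hypothesis M0 : (0 < M)%N.
Hypothesis ps0 : forall i j, (1 <= i <= N)%N -> (j <= M)%N -> 0 < ps i j.
Hypothesis dmu0 : forall i, (i <= N)%N -> 0 < dmu i.
Hypothesis dtheta0 : forall j, (j <= M)%N -> 0 < dtheta j.

Lemma dtheta_prev_gt0 j : (j <= M)%N -> 0 < dtheta_prev M dtheta j.
Proof. by case: j => [|j] jM; apply: dtheta0 => //; exact: ltnW. Qed.

Lemma B_row_ge0 (k : 'I_(M.+1 * N)) :
  0 <= (\row_(k < M.+1 * N)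
    let: (j, r) := mxtens_unindex k in ps r.+1 j) 0 k.
Proof.
rewrite mxE; case: (mxtens_unindex k) => j r.
by rewrite ltW // ps0 //= -ltnS.
Qed.

Lemma B_mx_mulE (A : 'M[R]_(M.+1 * N)) (j : 'I_M.+1) (r : 'I_N) k :
  (B_mx N M ps *m A) (mxtens_index (j, r)) k
  = ps r.+1 j * A (mxtens_index (j, r)) k.
Proof. by rewrite /B_mx mul_diag_mx mxE mxE mxtens_indexK. Qed.

Lemma C_mu_ge0 (i j : 'I_M.+1) : 0 <= C_mu R M i j.
Proof. by rewrite mxE; case: ifP. Qed.

Lemma sum_C_mu_row (i : 'I_M.+1) : \sum_j C_mu R M i j = 1.
Proof.
(* Column of the only 1 in row [i]: the reflection of the angular index that fixes 0. *)
pose k := if i == 0 :> nat then 0%N else (M.+1 - i)%N.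
have kM : (k < M.+1)%N.
  by rewrite /k; case: eqP => // /eqP; rewrite -lt0n => i0; lia.
rewrite (eq_bigr (fun j : 'I__ => if j == k :> nat then 1 else 0)).
  by rewrite sum_if_eq_ord kM.
move=> j _; rewrite mxE /k; case: (i : nat) => [|i'] //=.
by rewrite orbF.
Qed.

Lemma I_hat_ge0 (r c : 'I_N) : 0 <= I_hat N dmu r c.
Proof.
rewrite mxE; case: ifP => // _; have N0 : (0 < N)%N by case: r => /= r; case: N.
by rewrite divr_ge0 // mulr_ge0 ?addr_ge0 // ltW // dmu0.
Qed.

Lemma sum_I_hat_row (r : 'I_N) :
  \sum_c I_hat N dmu r c
  = if r == 0 :> nat then 2 / (dmu 0%N * (dmu 1%N + dmu 0%N)) else 0.
Proof.
have N0 : (0 < N)%N by case: r => /= r; case: N.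
under eq_bigr do rewrite mxE.
case: eqP => _ /=; last by rewrite big1.
by rewrite sum_if_eq_ord N0.
Qed.

Lemma sum_scalar1_row (n : nat) (i : 'I_n) : \sum_j (1%:M : 'M[R]_n) i j = 1.
Proof.
under eq_bigr do rewrite mxE -val_eqE eq_sym.
rewrite (eq_bigr (fun j : 'I__ => if j == i :> nat then 1 else 0)).
  by rewrite sum_if_eq_ord ltn_ord.
by move=> j _; case: eqP.
Qed.

Lemma T_mu_offdiag (r c : 'I_N) : r != c -> 0 <= T_mu N dmu r c.
Proof. by apply: second_diff_offdiag => i iN; rewrite dmu0 // ltnW. Qed.

Lemma T_theta_offdiag (i j : 'I_M.+1) : i != j -> 0 <= T_theta M dtheta i j.
Proof.
by apply: second_diff_offdiag => k kM; [exact: dtheta0|exact: dtheta_prev_gt0].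
Qed.

Lemma C_theta_ge0 (i j : 'I_M.+1) : 0 <= C_theta M dtheta i j.
Proof.
rewrite mxE; do 2?case: ifP => // _;
by rewrite divr_ge0 // mulr_ge0 ?addr_ge0 // ltW // dtheta0 // leq_pred.
Qed.

Lemma C_theta_diag (i : 'I_M.+1) : C_theta M dtheta i i = 0.
Proof.
rewrite mxE; have [->|_] := eqVneq (i : nat) 0%N.
  by rewrite eq_sym gtn_eqF.
by rewrite andbF.
Qed.

(* For M >= 1 the two periodic corner entries are the neighbour weights that
   truncation removes from the first and the last row of T_theta. *)
Lemma sum_theta_row (i : 'I_M.+1) :
  \sum_j T_theta M dtheta i j + \sum_j C_theta M dtheta i j = 0.
Proof.
rewrite sum_second_diff_row; [|exact: dtheta0|exact: dtheta_prev_gt0].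
have CE : \sum_j C_theta M dtheta i j
  = if i == 0 :> nat then 2 / (dtheta M * (dtheta 0%N + dtheta M))
    else if i == M :> nat then 2 / (dtheta M * (dtheta M.-1 + dtheta M)) else 0.
  under eq_bigr do rewrite mxE.
  have [i0|_] := eqVneq (i : nat) 0%N.
    rewrite i0 /= [0%N == M]eq_sym (gtn_eqF M0).
    by rewrite sum_if_eq_ord ltnSn.
  by case: eqP => _ /=; rewrite ?sum_if_eq_ord // big1.
rewrite CE eqSS; have [->|i0] := eqVneq (i : nat) 0%N.
  by rewrite eq_sym (gtn_eqF M0) /= subr0 addNr.
have [->|_] := eqVneq (i : nat) M; last by rewrite subr0 oppr0 addr0.
have -> : dtheta_prev M dtheta M = dtheta M.-1 by case: M M0.
by rewrite oppr0 add0r [dtheta M.-1 + _]addrC addNr.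
Qed.

(** In the first radial row [kappa3] restores the missing lower weight. The last row keeps a
    deficit, the weight of the outer boundary node, so its sum is negative. *)
Lemma dissipative_P : dissipative (P_mx N M ps dmu).
Proof.
apply: dissipative_diag_mul => [k|]; first exact: B_row_ge0.
split=> [k l|k].
  case: (mxtens_indexP k) => i r; case: (mxtens_indexP l) => j c kl.
  rewrite mxE !tensmxE [in X in X + _]mxE addr_ge0 //; last first.
    by rewrite mulr_ge0 ?C_mu_ge0 ?I_hat_ge0.
  have [ij|_] := eqVneq i j; last by rewrite mul0r.
  by rewrite mul1r T_mu_offdiag //; apply: contraNneq kl => ->; rewrite ij.
case: (mxtens_indexP k) => i r.
under eq_bigr do rewrite mxE.
rewrite big_split /= !sum_tensmx_row sum_scalar1_row sum_C_mu_row !mul1r.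
rewrite sum_I_hat_row sum_second_diff_row => [|j jN|j jN]; last 2 first.
- exact: dmu0.
- by rewrite dmu0 // ltnW.
have : 0 <= 2 / (dmu r.+1 * (dmu r.+1 + dmu r)).
  by rewrite divr_ge0 // mulr_ge0 ?addr_ge0 // ltW // dmu0 // ltnW.
have [->|_] := eqVneq (r : nat) 0%N; case: ifP => _ hi0; lra.
Qed.

(** Row sums vanish here: the periodic direction has no boundary. *)
Lemma dissipative_R : dissipative (R_mx N M ps dtheta).
Proof.
apply: dissipative_diag_mul => [k|]; first exact: B_row_ge0.
split=> [k l|k].
  case: (mxtens_indexP k) => i r; case: (mxtens_indexP l) => j c kl.
  rewrite mxE !tensmxE !(mxE _ _ r c) -mulrDl.
  have [rc|_] := eqVneq r c; last by rewrite mulr0.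
  rewrite mulr1 addr_ge0 ?C_theta_ge0 // T_theta_offdiag //.
  by apply: contraNneq kl => ->; rewrite rc.
case: (mxtens_indexP k) => i r.
under eq_bigr do rewrite mxE.
by rewrite big_split /= !sum_tensmx_row sum_scalar1_row !mulr1 sum_theta_row.
Qed.

(** At t = -2/d the claim is tau p/d <= 1. A lower bound on [t] is the right form because [C_mu] can
    meet the diagonal, in row 0 and where 2j = M + 1, and [kappa3] then raises the entry of
    [T_mu]. *)
Lemma step_diag_ge0 (tau d p t : R) :
  0 < tau -> 0 < d -> 0 < p -> tau <= d * p^-1 -> - (2 / d) <= t ->
  0 <= 1 + tau / 2 * (p * t).
Proof.
move=> tau0 d0 p0 le_tau le_t.
have h : tau / 2 * (p * - (2 / d)) <= tau / 2 * (p * t).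
  by rewrite ler_pM2l ?divr_gt0 // ler_pM2l.
have -> : 1 + tau / 2 * (p * t)
  = (1 - tau * p / d) + (tau / 2 * (p * t) - tau / 2 * (p * - (2 / d))).
  by field; rewrite gt_eqF.
by rewrite addr_ge0 // subr_ge0 // ler_pdivrMr // mul1r -ler_pdivlMr.
Qed.

Variable tau : R.
Hypothesis tau0 : 0 < tau.
Hypothesis tau_lt : (tau%:E < step_bound N M ps dmu dtheta)%E.

Lemma step_bound_lt (r : 'I_N) (j : 'I_M.+1) :
  tau < Num.min (dmu r.+1 * dmu r) (dtheta j * dtheta_prev M dtheta j)
        * (ps r.+1 j)^-1.
Proof.
(* Each minimum gives a bound by the neutral +oo, dropped, and one bound per index. *)
have /bigmin_gtP[_ /(_ r isT)/bigmin_gtP[_ /(_ j isT)]] := tau_lt.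
by rewrite lte_fin.
Qed.

Lemma P_diag_step k : 0 <= 1 + tau / 2 * P_mx N M ps dmu k k.
Proof.
case: (mxtens_indexP k) => j r; rewrite B_mx_mulE.
have p0 : 0 < ps r.+1 j by rewrite ps0 //= -ltnS.
apply: (@step_diag_ge0 _ (dmu r.+1 * dmu r)) => //.
- by rewrite mulr_gt0 ?dmu0 // ltnW.
- apply: le_trans (ltW (step_bound_lt r j)) _.
  by rewrite ler_pM2r ?invr_gt0 // ge_min lexx.
rewrite mxE !tensmxE mxE eqxx mul1r second_diff_diag lerDl.
by rewrite mulr_ge0 ?C_mu_ge0 ?I_hat_ge0.
Qed.

Lemma R_diag_step k : 0 <= 1 + tau / 2 * R_mx N M ps dtheta k k.
Proof.
case: (mxtens_indexP k) => j r; rewrite B_mx_mulE.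
have p0 : 0 < ps r.+1 j by rewrite ps0 //= -ltnS.
apply: (@step_diag_ge0 _ (dtheta j * dtheta_prev M dtheta j)) => //.
- by rewrite mulr_gt0 ?dtheta0 ?dtheta_prev_gt0 // -ltnS.
- apply: le_trans (ltW (step_bound_lt r j)) _.
  by rewrite ler_pM2r ?invr_gt0 // ge_min lexx orbT.
rewrite mxE !tensmxE C_theta_diag mul0r addr0 (mxE _ _ r r) eqxx mulr1.
by rewrite second_diff_diag.
Qed.

Lemma contraction_step :
  contraction (S_mx (P_mx N M ps dmu) (R_mx N M ps dtheta) tau).
Proof.
apply: contraction_S_mx.
- exact: ltW.
- exact: dissipative_P.
- exact: dissipative_R.
- exact: P_diag_step.
- exact: R_diag_step.
Qed.

End Splitting.

(** * Location of the grid nodes and positivity of [psi] *)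

Lemma lt_last_of_step (R : realType) (n : nat) (x : nat -> R) :
  (forall i, (i <= n)%N -> x i < x i.+1) ->
  forall i, (i <= n)%N -> x i < x n.+1.
Proof.
elim: n => [|n IHn] xS i; first by rewrite leqn0 => /eqP->; exact: xS.
rewrite leq_eqVlt => /predU1P[->|]; first exact: xS.
by rewrite ltnS => lein; apply: lt_trans (xS _ _) => //; apply: IHn => // j jn;
  apply: xS; exact: leqW.
Qed.

(** The half-step shift puts node 1 at [dmu 0 / 2]. Strict positivity keeps the nodes off the foci,
    where the denominator of [phi] vanishes. *)
Lemma mu_grid_inside (R : realType) (N : nat) (zeta : R) (mu dmu : nat -> R) i :
  mu_grid N zeta mu dmu -> (1 <= i <= N)%N -> 0 < mu i < zeta.
Proof.
move=> [dmu0 mu0 muS muN] /andP[i0 iN]; apply/andP; split.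
  elim: i i0 iN => // -[|i] IHi _ iN.
    by rewrite muS // mu0; have := dmu0 0%N isT => /= h; lra.
  by rewrite muS ?(leqW iN) //= addr_gt0 ?IHi ?dmu0 // ltnW.
rewrite -muN; apply: lt_last_of_step => // j jN.
by rewrite (muS j.+1) //= ltrDl dmu0.
Qed.

Lemma theta_grid_inside (R : realType) (M : nat) (theta dtheta : nat -> R) j :
  theta_grid M theta dtheta -> (j <= M)%N -> 0 <= theta j < 2 * pi.
Proof.
move=> [dt0 t0 tS tM] jM; apply/andP; split.
  elim: j jM => [|j IHj] jM; first by rewrite t0.
  by rewrite tS ?(leqW jM) //= addr_ge0 ?IHj ?ltW ?dt0 // ltnW.
rewrite -tM; apply: lt_last_of_step => // k kM.
by rewrite (tS k.+1) //= ltrDl dt0.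
Qed.

Lemma sinh_gt0 (R : realType) (x : R) : 0 < x -> 0 < sinh x.
Proof. by move=> x0; rewrite divr_gt0 // subr_gt0 ltr_expR; lra. Qed.

Lemma phi_gt0 (R : realType) (a mu theta : R) :
  0 < a -> 0 < mu -> 0 < phi a mu theta.
Proof.
move=> a0 mu0; rewrite divr_gt0 // mulr_gt0 ?exprn_gt0 //.
by rewrite ltr_pwDl ?sqr_ge0 // exprn_gt0 // sinh_gt0.
Qed.

Theorem theorem6 (R : realType) (N M : nat) (a zeta : R) (s : R -> R -> R)
    (mu dmu theta dtheta : nat -> R)
    (hN : (0 < N)%N) (hM : (0 < M)%N) (ha : 0 < a)
    (hmu : mu_grid N zeta mu dmu) (htheta : theta_grid M theta dtheta)
    (hs : forall x y : R, inside_ellipse zeta x y -> 0 < s x y)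
    (g : 'cV[R]_(M.+1 * N) -> 'cV[R]_(M.+1 * N))
    (tau : nat -> R) (v vt w : nat -> 'cV[R]_(M.+1 * N)) (m k : nat) :
  let ps := psi a s mu theta in
  let P := P_mx N M ps dmu in
  let Q := R_mx N M ps dtheta in
  (m <= k)%N ->
  (forall l, (m <= l <= k)%N -> 0 < tau l) ->
  (forall l, (m <= l <= k)%N -> ((tau l)%:E < step_bound N M ps dmu dtheta)%E) ->
  (forall l, (m <= l <= k)%N ->
     v l.+1 = splitting_step P Q (tau l) (g (w l.+1)) (g (v l)) (v l)) ->
  (* the perturbed run, with the reaction terms frozen at their values
     along v *)
  (forall l, (m <= l <= k)%N ->
     vt l.+1 = splitting_step P Q (tau l) (g (w l.+1)) (g (v l)) (vt l)) ->
  mx_norm (v k.+1 - vt k.+1) <= mx_norm (v m - vt m).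
Proof.
move=> ps P Q mk tau0 tau_lt vS vtS.
have dmu0 : forall i, (i <= N)%N -> 0 < dmu i by case: hmu.
have dtheta0 : forall j, (j <= M)%N -> 0 < dtheta j by case: htheta.
have ps0 i j : (1 <= i <= N)%N -> (j <= M)%N -> 0 < ps i j.
  move=> iN jM; have /andP[mu0 muz] := mu_grid_inside _ _ _ _ _ _ hmu iN.
  rewrite /ps /psi divr_gt0 ?phi_gt0 // hs //; split.
    by rewrite (ltW mu0).
  exact: theta_grid_inside htheta jM.
(* Induction on the number [p] of steps taken since time [m]. *)
suff decay p : (m + p <= k.+1)%N ->
    mx_norm (v (m + p)%N - vt (m + p)%N) <= mx_norm (v m - vt m).
  by have := decay (k.+1 - m)%N; rewrite subnKC ?(leqW mk) //; exact.
elim: p => [|p IHp]; first by rewrite addn0.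
rewrite addnS ltnS => pk; apply: le_trans (IHp (leqW pk)).
have lk : (m <= m + p <= k)%N by rewrite leq_addr.
rewrite vS // vtS // /splitting_step opprD addrACA subrr addr0 -mulmxBr.
exact: contraction_step hM ps0 dmu0 dtheta0 _ (tau0 _ lk) (tau_lt _ lk) _.
Qed.
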